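(* Let $\Gamma$ be a finite two-person zero-sum undiscounted player-2 controlled stochastic game that is completely mixed. Assume that every individual payoff matrix $R(s)$, $s\in S$, is symmetric. Then for every $s\in S$ the matrix game $R(s)$ is completely mixed.
   Context: A finite two-person zero-sum stochastic game consists of a finite state space $S=\{s_1,\dots,s_K\}$, finite nonempty sets $A_1(s),A_2(s)$ of pure actions of players 1 and 2 in each state $s\in S$, a real reward $r(i,j,s)$ paid by player 2 to player 1 when actions $i\in A_1(s)$, $j\in A_2(s)$ are chosen in state $s$, and transition probabilities $q(s'|s,i,j)$. The payoff matrix in state $s$ is $R(s)=(r(i,j,s))_{i,j}$. Player 1 maximizes, player 2 minimizes. The game is player-2 controlled if $q(s'|s,i,j)=q(s'|s,j)$ for all $s,s',i,j$. A stationary strategy of player $k$ assigns to each $s\in S$ a probability distribution on $A_k(s)$; $\mathbb{P}_k$ is the set of stationary strategies of player $k$. It is completely mixed if in every state every pure action has strictly positive probability. For $f\in\mathbb{P}_1$, $g\in\mathbb{P}_2$, let $r^{(n)}(f,g,s)$ be the expected reward to player 1 on day $n$ ($n=0,1,2,\dots$) when play starts in state $s$ and $(f,g)$ is used. The undiscounted payoff is $\Phi(f,g)(s)=\liminf_{N\to\infty}\frac1{N+1}\sum_{n=0}^N r^{(n)}(f,g,s)$. A pair $(f^0,g^0)$ of stationary strategies is optimal in the undiscounted game $\Gamma$ if $\Phi(f,g^0)\le\Phi(f^0,g^0)\le\Phi(f^0,g)$ coordinatewise (over states) for all $f\in\mathbb{P}_1,g\in\mathbb{P}_2$. $\Gamma$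 is completely mixed if every optimal stationary strategy of each player is completely mixed, i.e. in every optimal pair both strategies are completely mixed. A matrix game (zero-sum; the row player maximizes, the column player minimizes) is completely mixed if every optimal mixed strategy of each player has all coordinates strictly positive. *)

(* Defs.v *)
From HB Require Import structures.
From mathcomp Require Import all_boot all_order all_algebra.
From mathcomp Require Import all_classical all_reals all_analysis.

Set Implicit Arguments.
Unset Strict Implicit.
Unset Printing Implicit Defensive.

Import Order.TTheory GRing.Theory Num.Theory.

Local Open Scope ring_scope.

Section MatrixGame.
Variable R : realType.

Definition mixed (m : nat) (x : 'rV[R]_m) : Prop :=
  (forall i, 0 <= x 0 i) /\ \sum_i x 0 i = 1.

Definition positive (m : nat) (x : 'rV[R]_m) : Prop := forall i, 0 < x 0 i.

(* Expected amount received by the row player, who maximizes. *)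
Definition expected (m n : nat) (A : 'M[R]_(m, n))
    (x : 'rV[R]_m) (y : 'rV[R]_n) : R :=
  (x *m A *m y^T) 0 0.

Definition row_guarantees (m n : nat) (A : 'M[R]_(m, n))
    (x : 'rV[R]_m) (v : R) : Prop :=
  mixed x /\ forall y, mixed y -> v <= expected A x y.

Definition col_guarantees (m n : nat) (A : 'M[R]_(m, n))
    (y : 'rV[R]_n) (v : R) : Prop :=
  mixed y /\ forall x, mixed x -> expected A x y <= v.

(* Such a v is unique, and exists by the minimax theorem when m, n > 0. *)
Definition game_value (m n : nat) (A : 'M[R]_(m, n)) (v : R) : Prop :=
  (exists x, row_guarantees A x v) /\ (exists y, col_guarantees A y v).

Definition row_optimal (m n : nat) (A : 'M[R]_(m, n)) (x : 'rV[R]_m) : Prop :=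
  exists2 v, game_value A v & row_guarantees A x v.

Definition col_optimal (m n : nat) (A : 'M[R]_(m, n)) (y : 'rV[R]_n) : Prop :=
  exists2 v, game_value A v & col_guarantees A y v.

Definition completely_mixed_matrix_game (m n : nat) (A : 'M[R]_(m, n)) : Prop :=
  (forall x, row_optimal A x -> positive x) /\
  (forall y, col_optimal A y -> positive y).

(* Symmetry of a matrix whose two dimensions are not syntactically equal:
   A is square and, up to the cast along that equality, A = A^T. *)
Definition symmetric_matrix (m n : nat) (A : 'M[R]_(m, n)) : Prop :=
  exists e : n = m, A = castmx (e, esym e) A^T.

End MatrixGame.

(* The actions of player k in state s are numbered by 'I_(mk s). *)
Record stochastic_game (R : realType) (S : finType) := StochasticGame {
  m1 : S -> nat;
  m2 : S -> nat;
  m1_gt0 : forall s, (0 < m1 s)%N;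
  m2_gt0 : forall s, (0 < m2 s)%N;
  reward : forall s, 'M[R]_(m1 s, m2 s);
  (* trans i j s' is q(s' | s, i, j) *)
  trans : forall s, 'I_(m1 s) -> 'I_(m2 s) -> S -> R;
  trans_ge0 : forall s (i : 'I_(m1 s)) (j : 'I_(m2 s)) s', 0 <= trans i j s';
  trans_sum1 : forall s (i : 'I_(m1 s)) (j : 'I_(m2 s)),
    \sum_s' trans i j s' = 1
}.

Section StochasticGame.
Variables (R : realType) (S : finType) (G : stochastic_game R S).

Definition player2_controlled : Prop :=
  exists q : forall s, 'I_(m2 G s) -> S -> R,
    forall s (i : 'I_(m1 G s)) (j : 'I_(m2 G s)) s', trans i j s' = q s j s'.

Definition profile1 := forall s, 'rV[R]_(m1 G s).
Definition profile2 := forall s, 'rV[R]_(m2 G s).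

Definition stationary1 (f : profile1) : Prop := forall s, mixed (f s).
Definition stationary2 (g : profile2) : Prop := forall s, mixed (g s).

Definition completely_mixed1 (f : profile1) : Prop := forall s, positive (f s).
Definition completely_mixed2 (g : profile2) : Prop := forall s, positive (g s).

Definition step_prob (f : profile1) (g : profile2) (s s' : S) : R :=
  \sum_(i < m1 G s) \sum_(j < m2 G s) f s 0 i * g s 0 j * trans i j s'.

(* Probability of being in state t on day n when play starts in s. *)
Fixpoint state_prob (f : profile1) (g : profile2) (n : nat) (s t : S) : R :=
  if n is k.+1 then \sum_u state_prob f g k s u * step_prob f g u t
  else (s == t)%:R.

(* r^(n)(f, g, s) *)
Definition day_reward (f : profile1) (g : profile2) (n : nat) (s : S) : R :=
  \sum_t state_prob f g n s t * expected (reward G t) (f t) (g t).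

(* For stationary f and g the averages are bounded, so that the real-valued
   limn_inf is the genuine lower limit. *)
Definition undiscounted_payoff (f : profile1) (g : profile2) (s : S) : R :=
  limn_inf (fun N : nat => (N.+1%:R)^-1 * \sum_(n < N.+1) day_reward f g n s).

Definition optimal_pair (f0 : profile1) (g0 : profile2) : Prop :=
  [/\ stationary1 f0,
      stationary2 g0,
      forall f, stationary1 f -> forall s,
        undiscounted_payoff f g0 s <= undiscounted_payoff f0 g0 s
    & forall g, stationary2 g -> forall s,
        undiscounted_payoff f0 g0 s <= undiscounted_payoff f0 g s].

Definition completely_mixed_game : Prop :=
  forall f0 g0, optimal_pair f0 g0 ->
    completely_mixed1 f0 /\ completely_mixed2 g0.

End StochasticGame.

(* Main.v *)
Require Import Defs.
From mathcomp Require Import all_boot all_order all_algebra.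
From mathcomp Require Import all_classical all_reals all_analysis.
From mathcomp Require Import ring lra.
From HB Require Import structures.

(** The theorem rests on a certificate of optimality for a pair (f, g): a
    candidate value v, a bias h, a set X of states and a potential e such that,
    whatever player 2 does, v and v + h are dominated by the one-step equations
    of an average-cost decision process with reward f R (so f guarantees v),
    while under g the value v is preserved, every action of player 1 is at most
    as good as v + h predicts on X, and e drifts down by one unit outside X, so
    that the time spent there is negligible (so g guarantees v).  Only player 2
    moves the state, hence the drift of v, h and e depends on g alone.

    A certificate exists by linear programming duality.  The primal program
    maximizes the sum of v subject to the conditions on (f, v, h).  A dual
    solution consists of occupation weights x and y; g is x normalized where x
    does not vanish and y normalized elsewhere, X is the support of x, and e is
    a solution of the Poisson equation e = 1 + P e outside X, solvable because
    y bounds the number of visits to each state outside X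
    ([certificate_exists]).

    Since the game is completely mixed, f and g are everywhere positive, and so
    is every pair obtained by perturbing the certificate.  Two perturbations
    are used.  In a state s of X, complementary slackness makes R(s) g(s)
    constant.  A nonzero d with sum zero and d R(s) = 0 could be added to f(s)
    until a coordinate vanishes, which keeps the certificate
    ([certificate_perturb1]); hence there is no such d.  As R(s) is symmetric,
    g(s) equalizes for both players, so that every optimal strategy differs
    from it by a vector d of that kind and is equal to it
    ([completely_mixed_of_equalizer]).  In a state s outside X, complementary
    slackness makes every action of player 2 preserve v, and g(s) can be
    replaced by the single action with the least mean of e
    ([certificate_perturb2]); positivity then leaves player 2, and by symmetry
    player 1, with a single action. *)

Set Implicit Arguments.
Unset Strict Implicit.
Unset Printing Implicit Defensive.

Import Order.TTheory GRing.Theory Num.Theory.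

Import numFieldNormedType.Exports.
Local Open Scope ring_scope.

(** * Linear programming duality *)

Section LinearProgramming.

Lemma scalar_sum (R : pzRingType) (V : lmodType R) (I : Type) (r : seq I)
    (P : pred I) (a : I -> V -> R) :
  (forall i, scalar (a i)) -> scalar (fun x => \sum_(i <- r | P i) a i x).
Proof.
move=> lin k x y; rewrite mulr_sumr -big_split; apply: eq_bigr => i _.
exact: lin.
Qed.

Lemma scalar_mulrl (R : comPzRingType) (V : lmodType R) (c : R) (a : V -> R) :
  scalar a -> scalar (fun x => c * a x).
Proof. by move=> lin k x y; rewrite lin mulrDr mulrCA. Qed.

Lemma scalarB (R : pzRingType) (V : lmodType R) (a b : V -> R) :
  scalar a -> scalar b -> scalar (fun x => a x - b x).
Proof. by move=> la lb k x y; rewrite la lb mulrBr opprD addrACA. Qed.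

Lemma scalarD (R : pzRingType) (V : lmodType R) (a b : V -> R) :
  scalar a -> scalar b -> scalar (fun x => a x + b x).
Proof. by move=> la lb k x y; rewrite la lb mulrDr addrACA. Qed.

Lemma big_option (R : nmodType) (I : finType) (F : option I -> R) :
  \sum_o F o = F None + \sum_i F (Some i).
Proof.
rewrite (bigD1 None)//= (reindex_omap Some id); last by case.
by congr (_ + _); apply: eq_bigl => i; rewrite /= eqxx.
Qed.

(** Farkas' lemma, by Bartl's induction on the number of constraints.  If the
    new constraint a i0 cannot be dropped, some z satisfies the others but has
    c z > 0, hence a i0 z > 0.  Projecting along z onto the kernel of a i0
    turns the problem into one with the remaining constraints, and the
    multiplier of a i0 is recovered by evaluating at z. *)
Lemma farkas (R : realFieldType) (V : lmodType R) (I : eqType) (r : seq I)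
    (a : I -> V -> R) (c : V -> R) :
    uniq r -> (forall i, scalar (a i)) -> scalar c ->
    (forall x, (forall i, i \in r -> a i x <= 0) -> c x <= 0) ->
  exists2 l : I -> R, (forall i, 0 <= l i)
    & forall x, c x = \sum_(i <- r) l i * a i x.
Proof.
elim: r a c => [|i0 r IH] a c /=.
  move=> _ _ linc cle0; exists (fun=> 0) => // x; rewrite big_nil.
  have := cle0 (- x) (fun _ _ => ltac:(by [])).
  have := cle0 x (fun _ _ => ltac:(by [])).
  have -> : c (- x) = - c x.
    have c0 : c 0 = 0.
      by have := linc (-1) 0 0; rewrite scaler0 addr0 mulN1r addNr.
    by have := linc (-1) x 0; rewrite c0 !addr0 scaleN1r mulN1r.
  by rewrite oppr_le0 => ? ?; apply/eqP; rewrite eq_le; apply/andP.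
move=> /andP[i0r ur] lina linc cle0.
have [H|] := pselect (forall x, (forall i, i \in r -> a i x <= 0) -> c x <= 0).
  have [l l0 lE] := IH a c ur lina linc H.
  exists (fun i => if i == i0 then 0 else l i) => [i|x]; first by case: ifP.
  rewrite big_cons eqxx mul0r add0r lE.
  apply: eq_big_seq => i ir; case: eqP => // ii0.
  by move: i0r; rewrite -ii0 ir.
move=> /existsNP[z /not_implyP[az /negP]]; rewrite -ltNge => cz.
have a0z : 0 < a i0 z.
  rewrite ltNge; apply/negP => a0z.
  have := cle0 z; rewrite leNgt cz => /(_ _)/negP; apply => //.
  by move=> i; rewrite inE => /orP[/eqP->//|/az].
pose pr x := x - (a i0 x / a i0 z) *: z.
have prE b : scalar b -> forall x, b (pr x) = b x - (a i0 x / a i0 z) * b z.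
  by move=> lb x; rewrite /pr -scaleNr [x + _]addrC lb mulNr addrC.
have linpr b : scalar b -> scalar (b \o pr).
  move=> lb k x y /=; rewrite !prE// lb (lina i0); ring.
have [x xle|l l0 lE] := IH (fun i => a i \o pr) (c \o pr) ur
    (fun i => linpr _ (lina i)) (linpr _ linc).
  apply: cle0 => i; rewrite inE => /orP[/eqP->|]; last exact: xle.
  by rewrite prE// divfK ?subrr// gt_eqF.
pose l' i :=
  if i == i0 then (c z - \sum_(i <- r) l i * a i z) / a i0 z else l i.
exists l' => [i|x].
  rewrite /l'; case: ifP => // _; rewrite divr_ge0 ?(ltW a0z)// subr_ge0.
  apply: le_trans (ltW cz); rewrite big_seq; apply: sumr_le0 => j jr.
  by rewrite mulr_ge0_le0// az.
rewrite big_cons {1}/l' eqxx.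
have -> : \sum_(j <- r) l' j * a j x = \sum_(j <- r) l j * a j x.
  apply: eq_big_seq => i ir; rewrite /l'; case: eqP => // ii0.
  by move: i0r; rewrite -ii0 ir.
have := lE x; rewrite /= prE//.
under eq_bigr => i _ do rewrite prE// mulrBr mulrCA.
rewrite sumrB -mulr_sumr => /eqP; rewrite subr_eq => /eqP ->.
rewrite mulrAC; ring.
Qed.

(** Strong duality with complementary slackness, for a feasible program whose
    objective does not increase along its recession cone.  Both halves are
    Farkas' lemma for the homogenized system in (x, t): every upper bound theta
    of the values yields a dual solution of value at most theta, and if the
    supremum were not attained, some dual solution would have a smaller value
    than the supremum. *)
Lemma linear_program_duality (R : realType) (V : lmodType R) (I : finType)
    (a : I -> V -> R) (b : I -> R) (c : V -> R) :
    (forall i, scalar (a i)) -> scalar c ->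
    (exists x, forall i, a i x <= b i) ->
    (forall u, (forall i, a i u <= 0) -> c u <= 0) ->
  exists x l, [/\ forall i, a i x <= b i, forall i, 0 <= l i,
    forall u, \sum_i l i * a i u = c u
    & forall i, l i * (b i - a i x) = 0].
Proof.
move=> lina linc [x0 x0b] rec.
have scal0 (d : V -> R) : scalar d -> d 0 = 0.
  by move=> ld; have := ld (-1) 0 0; rewrite scaler0 addr0 mulN1r addNr.
have scalZ (d : V -> R) k u : scalar d -> d (k *: u) = k * d u.
  by move=> ld; have := ld k u 0; rewrite addr0 scal0// addr0.
pose W := (V * R^o)%type.
pose lift (d : V -> R) (e : R) (w : W) : R := d w.1 - e * w.2.
have linlift d e : scalar d -> scalar (lift d e).
  by move=> ld k u w; rewrite /lift /= ld /GRing.scale /=; ring.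
have snd_lin : scalar (fun w : W => w.2 : R) by [].
have sndN_lin : scalar (fun w : W => - w.2 : R).
  by move=> k u w /=; rewrite opprD mulrN.
have dual theta : (forall x, (forall i, a i x <= b i) -> c x <= theta) ->
    exists l, [/\ forall i, 0 <= l i, forall u, \sum_i l i * a i u = c u
      & \sum_i l i * b i <= theta].
  move=> ub.
  pose al (o : option I) : W -> R :=
    if o is Some i then lift (a i) (b i) else fun w => - w.2.
  have [||[u t] /= H|l l0 lE] :=
      @farkas R W _ (index_enum _) al (lift c theta) (index_enum_uniq _).
  - by case=> [i|] //=; exact: linlift.
  - exact: linlift.
  - have t0 : 0 <= t by have := H None (mem_index_enum _); rewrite /= oppr_le0.
    have {}H i : a i u <= b i * t.
      by have := H (Some i) (mem_index_enum _); rewrite /= /lift /= subr_le0.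
    (* t = 0 is a recession direction, t > 0 rescales to a feasible point *)
    rewrite /lift /= subr_le0; move: t0; rewrite le_eqVlt => /orP[/eqP t0|t0].
      rewrite -t0 mulr0; apply: rec => i; rewrite (le_trans (H i))//.
      by rewrite -t0 mulr0.
    rewrite -ler_pdivrMr// mulrC -scalZ//; apply: ub => i.
    by rewrite scalZ// mulrC ler_pdivrMr.
  exists (l \o some); split => [i|u|]; first exact: l0.
    have := lE (u, 0); rewrite big_option /= /lift /= oppr0 !mulr0 subr0 add0r.
    by move=> ->; apply: eq_bigr => i _; rewrite mulr0 subr0.
  have := lE (0, 1); rewrite big_option /= /lift /= mulrN !mulr1 scal0// sub0r.
  under eq_bigr do rewrite scal0// sub0r mulr1 mulrN.
  by rewrite sumrN; have := l0 None; lra.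
have bounded : exists m, forall x, (forall i, a i x <= b i) -> c x <= m.
  have [||l l0 lE] := @farkas R V _ (index_enum _) a c (index_enum_uniq _) lina.
  - exact: linc.
  - by move=> u H; apply: rec => i; apply: H; exact: mem_index_enum.
  - exists (\sum_i l i * b i) => x xb; rewrite lE.
    by apply: ler_sum => i _; rewrite ler_wpM2l.
pose E : set R := [set c x | x in [set x | forall i, a i x <= b i]]%classic.
have Eub : has_ubound E.
  by have [m mP] := bounded; exists m => _ [x xb <-]; exact: mP.
have E0 : (E !=set0)%classic by exists (c x0), x0.
have [l [l0 lE lb]] : exists l, [/\ forall i, 0 <= l i,
    forall u, \sum_i l i * a i u = c u & \sum_i l i * b i <= sup E].
  by apply: dual => x xb; apply: ub_le_sup => //; exists x.
have [x xb xE] : exists2 x, forall i, a i x <= b i & sup E <= c x.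
  apply: contrapT => nx.
  pose al (o : option I) : W -> R :=
    if o is Some i then lift (a i) (b i) else lift (fun u => - c u) (- sup E).
  have linN : scalar (fun u => - c u).
    by move=> k u w /=; rewrite linc opprD mulrN.
  have [||[u t] /= H|m m0 mE] := @farkas R W _ (index_enum _) al
      (fun w => w.2) (index_enum_uniq _).
  - by case=> [i|] /=; exact: linlift.
  - exact: snd_lin.
  - rewrite leNgt; apply/negP => t0; apply: nx; exists (t^-1 *: u) => [i|].
      rewrite scalZ// mulrC ler_pdivrMr//.
      by have := H (Some i) (mem_index_enum _); rewrite /= /lift /= subr_le0.
    rewrite scalZ// mulrC ler_pdivlMr//.
    by have := H None (mem_index_enum _); rewrite /= /lift /=; lra.
  have mE1 u : \sum_i m (Some i) * a i u = m None * c u.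
    have := mE (u, 0); rewrite big_option /= /lift /= !mulr0 subr0 mulrN.
    under eq_bigr do rewrite mulr0 subr0.
    by move/esym/eqP; rewrite addrC subr_eq0 => /eqP.
  have mE2 : \sum_i m (Some i) * b i = m None * sup E - 1.
    have := mE (0, 1); rewrite big_option /= /lift /= !mulr1 scal0//.
    under eq_bigr do rewrite scal0// sub0r mulr1 mulrN.
    by rewrite sumrN; lra.
  have mb y : (forall i, a i y <= b i) -> m None * c y <= m None * sup E - 1.
    by move=> yb; rewrite -mE1 -mE2; apply: ler_sum => i _; rewrite ler_wpM2l.
  (* a null multiplier of the objective contradicts feasibility; a positive
     one gives the bound sup E - 1 / m None on all values *)
  have := m0 None; rewrite le_eqVlt => /orP[/eqP m00|m00].
    by have := mb _ x0b; rewrite -m00; lra.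
  suff : sup E <= sup E - (m None)^-1 by have := m00; rewrite -invr_gt0; lra.
  apply: ge_sup => // _ [y yb <-].
  rewrite -(ler_pM2l m00) mulrBr divff ?gt_eqF//.
  exact: mb.
exists x, l; split => // i.
have term0 j : 0 <= l j * (b j - a j x) by rewrite mulr_ge0// subr_ge0.
apply: (@psumr_eq0P _ I xpredT (fun j => l j * (b j - a j x))) => //.
apply: le_anti; apply/andP; split; last exact: sumr_ge0.
have -> : \sum_i l i * (b i - a i x) = \sum_i l i * b i - c x.
  by rewrite -lE -sumrB; apply: eq_bigr => j _; rewrite mulrBr.
by rewrite subr_le0 (le_trans lb).
Qed.

End LinearProgramming.
(** * Lower limits and long-run averages *)

Section LowerLimit.
Variable R : realType.
Implicit Types (u : R ^nat) (l c : R).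

Lemma cvgn_add_mul_harmonic l c :
  ((fun n => l + c * (n.+1%:R)^-1) @ \oo --> (l : R^o))%classic.
Proof.
have {2}-> : l = l + c * 0 by rewrite mulr0 addr0.
by apply: cvgD; [exact: cvg_cst|apply: cvgMr; exact: cvg_harmonic].
Qed.

Lemma cvgn_infs u a b :
  (forall n, a <= u n) -> (forall n, u n <= b) -> cvgn (infs u).
Proof.
move=> au ub; apply/cvg_ex; exists (sup (range (infs u))); apply: cvg_infs_sup.
- by exists b => _ [n _ <-]; exact: ub.
- by exists a => _ [n _ <-]; exact: au.
Qed.

(** The upper bound b makes the sequence of tail infima converge, so that
    [limn_inf] is the genuine lower limit; likewise for a in [limn_inf_le]. *)
Lemma limn_inf_ge u l c b :
    (forall n, l - c * (n.+1%:R)^-1 <= u n) -> (forall n, u n <= b) ->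
    0 <= c -> l <= limn_inf u.
Proof.
move=> lu ub c0; have h1 n : (n.+1%:R)^-1 <= 1 :> R by rewrite invf_le1 ?ler1n.
have cv : cvgn (infs u).
  apply: (@cvgn_infs u (l - c)) ub => n; apply: le_trans (lu n).
  by rewrite lerD2l lerN2 ler_piMr.
rewrite -(cvg_lim _ (@cvgn_add_mul_harmonic l (- c)))//.
apply: ler_lim => //.
  by apply/cvg_ex; exists l; exact: cvgn_add_mul_harmonic.
apply: nearW => n; apply: lb_le_inf; first by exists (u n), n => /=.
move=> _ [k /= nk <-]; apply: le_trans (lu k); rewrite mulNr lerD2l lerN2.
by rewrite ler_wpM2l// lef_pV2 ?posrE ?ltr0n// ler_nat.
Qed.

Lemma limn_inf_le u l c a :
    (forall n, u n <= l + c * (n.+1%:R)^-1) -> (forall n, a <= u n) ->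
    0 <= c -> limn_inf u <= l.
Proof.
move=> ul au c0; have h1 n : (n.+1%:R)^-1 <= 1 :> R by rewrite invf_le1 ?ler1n.
have cv : cvgn (infs u).
  apply: (@cvgn_infs u a (l + c)) => // n; apply: le_trans (ul n) _.
  by rewrite lerD2l ler_piMr.
rewrite -(cvg_lim _ (@cvgn_add_mul_harmonic l c))//.
apply: ler_lim => //.
  by apply/cvg_ex; exists l; exact: cvgn_add_mul_harmonic.
apply: nearW => n; apply: le_trans (ul n).
apply: ge_inf; last by exists n => /=.
by exists a => _ [k _ <-]; exact: au.
Qed.

End LowerLimit.

Section Averages.
Variables (R : realType) (S : finType) (G : stochastic_game R S).
Variables (f : profile1 G) (g : profile2 G).
Hypotheses (hf : stationary1 f) (hg : stationary2 g).

Lemma step_prob_ge0 s t : 0 <= step_prob f g s t.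
Proof.
apply: sumr_ge0 => i _; apply: sumr_ge0 => j _.
by rewrite !mulr_ge0 ?trans_ge0 ?(hf s).1 ?(hg s).1.
Qed.

Lemma step_prob_sum1 s : \sum_t step_prob f g s t = 1.
Proof.
rewrite exchange_big /= -(hf s).2; apply: eq_bigr => i _.
rewrite exchange_big /= -[RHS]mulr1 -(hg s).2 mulr_sumr; apply: eq_bigr => j _.
by rewrite -mulr_sumr trans_sum1 mulr1.
Qed.

Lemma state_prob_ge0 n s t : 0 <= state_prob f g n s t.
Proof.
elim: n t => [|n IH] t /=; first by rewrite ler0n.
by apply: sumr_ge0 => u _; rewrite mulr_ge0 ?IH ?step_prob_ge0.
Qed.

Lemma state_probS n s (w : S -> R) :
  \sum_t state_prob f g n.+1 s t * w t =
  \sum_t state_prob f g n s t * (\sum_u step_prob f g t u * w u).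
Proof.
under eq_bigr do rewrite /= mulr_suml.
rewrite exchange_big; apply: eq_bigr => t _; rewrite mulr_sumr.
by apply: eq_bigr => u _; rewrite mulrA.
Qed.

Lemma state_prob0 s (w : S -> R) : \sum_t state_prob f g 0 s t * w t = w s.
Proof.
rewrite (bigD1 s)//= eqxx mul1r big1 ?addr0// => t ts.
by rewrite eq_sym (negbTE ts) mul0r.
Qed.

Lemma state_prob_sum1 n s : \sum_t state_prob f g n s t = 1.
Proof.
have -> : \sum_t state_prob f g n s t = \sum_t state_prob f g n s t * 1.
  by under [RHS]eq_bigr do rewrite mulr1.
elim: n => [|n IH]; first exact: (state_prob0 s (fun=> 1)).
rewrite (state_probS n s (fun=> 1)) -[RHS]IH.
apply: eq_bigr => t _; congr (_ * _).
by rewrite -[RHS](step_prob_sum1 t); apply: eq_bigr => u _; rewrite mulr1.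
Qed.

Lemma state_prob_mono n s (v w : S -> R) : (forall t, v t <= w t) ->
  \sum_t state_prob f g n s t * v t <= \sum_t state_prob f g n s t * w t.
Proof.
by move=> vw; apply: ler_sum => t _; rewrite ler_wpM2l ?state_prob_ge0.
Qed.

Lemma state_prob_cst n s (c : R) : \sum_t state_prob f g n s t * c = c.
Proof. by rewrite -mulr_suml state_prob_sum1 mul1r. Qed.

Lemma state_prob_sub (v : S -> R) n s :
  (forall t, v t <= \sum_u step_prob f g t u * v u) ->
  v s <= \sum_t state_prob f g n s t * v t.
Proof.
move=> sub; elim: n => [|n IH]; first by rewrite state_prob0.
by rewrite (le_trans IH)// state_probS state_prob_mono.
Qed.

(** The bias inequality telescopes along the play: day n contributes at least
    the mean of v + h on day n minus the mean of h on day n + 1, and the mean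
    of v does not decrease. *)
Lemma sum_rewards_ge (rho v h : S -> R) N s :
    (forall t, v t <= \sum_u step_prob f g t u * v u) ->
    (forall t, v t + h t <= rho t + \sum_u step_prob f g t u * h u) ->
  N%:R * v s + h s - \sum_t state_prob f g N s t * h t <=
    \sum_(n < N) \sum_t state_prob f g n s t * rho t.
Proof.
move=> sub bias; elim: N => [|N IH].
  by rewrite big_ord0 state_prob0 mul0r add0r subrr.
rewrite big_ord_recr /=.
have := state_prob_mono N s bias.
have dist (a b : S -> R) : \sum_t state_prob f g N s t * (a t + b t) =
    \sum_t state_prob f g N s t * a t + \sum_t state_prob f g N s t * b t.
  by rewrite -big_split; apply: eq_bigr => t _; rewrite mulrDr.
rewrite !dist -(state_probS N s h) /= => b.
have := state_prob_sub N s sub.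
rewrite -natr1 mulrDl mul1r; lra.
Qed.

Definition stage_reward (t : S) : R := expected (reward G t) (f t) (g t).

Let average (N : nat) (s : S) : R :=
  (N.+1%:R)^-1 * \sum_(n < N.+1) day_reward f g n s.

Lemma sup_norm (w : S -> R) : exists2 M : R, 0 <= M & forall t, `|w t| <= M.
Proof.
exists (\sum_t `|w t|) => [|t]; first exact: sumr_ge0.
by rewrite (bigD1 t)//= lerDl sumr_ge0.
Qed.

Lemma average_ge (v h : S -> R) :
    (forall t, v t <= \sum_u step_prob f g t u * v u) ->
    (forall t, v t + h t <= stage_reward t + \sum_u step_prob f g t u * h u) ->
  exists2 c : R, 0 <= c & forall N s, v s - c * (N.+1%:R)^-1 <= average N s.
Proof.
move=> sub bias; have [M M0 hM] := sup_norm h.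
exists (M + M) => [|N s]; first by rewrite addr_ge0.
rewrite /average [leRHS]mulrC ler_pdivlMr ?ltr0n// mulrBl divfK ?pnatr_eq0//.
apply: le_trans (sum_rewards_ge N.+1 s sub bias); rewrite mulrC.
have hb t : `|h t| <= M by [].
have := hb s; rewrite ler_norml => /andP[+ _].
have : \sum_t state_prob f g N.+1 s t * h t <= M.
  rewrite -(state_prob_cst N.+1 s M); apply: state_prob_mono => t.
  by rewrite (le_trans _ (hb t))// ler_norm.
lra.
Qed.

(** This is [sum_rewards_ge] for the opposite rewards. *)
Lemma average_le (v h : S -> R) :
    (forall t, \sum_u step_prob f g t u * v u <= v t) ->
    (forall t, stage_reward t + \sum_u step_prob f g t u * h u <= v t + h t) ->
  exists2 c : R, 0 <= c & forall N s, average N s <= v s + c * (N.+1%:R)^-1.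
Proof.
move=> super bias; have [M M0 hM] := sup_norm h.
exists (M + M) => [|N s]; first by rewrite addr_ge0.
have opp (w : S -> R) n t :
    \sum_u state_prob f g n t u * - w u = - \sum_u state_prob f g n t u * w u.
  by rewrite -sumrN; apply: eq_bigr => u _; rewrite mulrN.
have opp1 (w : S -> R) t :
    \sum_u step_prob f g t u * - w u = - \sum_u step_prob f g t u * w u.
  by rewrite -sumrN; apply: eq_bigr => u _; rewrite mulrN.
have sub t : - v t <= \sum_u step_prob f g t u * - v u by rewrite opp1 lerN2.
have bias' t : - v t + - h t <=
    - stage_reward t + \sum_u step_prob f g t u * - h u.
  by rewrite opp1 -!opprD lerN2.
have := @sum_rewards_ge (fun t => - stage_reward t) _ _ N.+1 s sub bias'.
rewrite opp; under [leRHS]eq_bigr do rewrite opp.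
rewrite sumrN mulrN => le1.
rewrite /average [leLHS]mulrC ler_pdivrMr ?ltr0n// mulrDl divfK ?pnatr_eq0//.
have hb t : `|h t| <= M by [].
have := hb s; rewrite ler_norml => /andP[_].
have : - M <= \sum_t state_prob f g N.+1 s t * h t.
  rewrite -(state_prob_cst N.+1 s (- M)); apply: state_prob_mono => t.
  by have := hb t; rewrite ler_norml => /andP[].
move: le1; rewrite /day_reward /stage_reward [v s * _]mulrC; lra.
Qed.

(** Constant functions v, with h = 0, satisfy the one-step inequalities. *)
Lemma average_bounded : exists M : R, forall N s, - M <= average N s <= M.
Proof.
have [M M0 hM] := sup_norm stage_reward.
have cst (c : R) t : \sum_u step_prob f g t u * c = c.
  by rewrite -mulr_suml step_prob_sum1 mul1r.
have [||c c0 lb] := @average_ge (fun=> - M) (fun=> 0); rewrite /=.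
- by move=> t; rewrite cst.
- by move=> t; rewrite cst !addr0; have := hM t; rewrite ler_norml => /andP[].
have [||d d0 ub] := @average_le (fun=> M) (fun=> 0); rewrite /=.
- by move=> t; rewrite cst.
- by move=> t; rewrite cst !addr0; have := hM t; rewrite ler_norml => /andP[].
have h1 n : (n.+1%:R)^-1 <= 1 :> R by rewrite invf_le1 ?ler1n.
exists (M + c + d) => N s; apply/andP; split.
  apply: le_trans (lb N s); have : c * (N.+1%:R)^-1 <= c by rewrite ler_piMr.
  rewrite /=; move: (c * _) => x; lra.
apply: le_trans (ub N s) _; have : d * (N.+1%:R)^-1 <= d by rewrite ler_piMr.
rewrite /=; move: (d * _) => x; lra.
Qed.

Lemma undiscounted_payoff_ge (v h : S -> R) :
    (forall t, v t <= \sum_u step_prob f g t u * v u) ->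
    (forall t, v t + h t <= stage_reward t + \sum_u step_prob f g t u * h u) ->
  forall s, v s <= undiscounted_payoff f g s.
Proof.
move=> sub bias s; have [c c0 lb] := average_ge sub bias.
have [M bM] := average_bounded.
apply: (@limn_inf_ge R (average ^~ s) (v s) c M) => // N.
by have /andP[] := bM N s.
Qed.

Lemma undiscounted_payoff_le (v h : S -> R) :
    (forall t, \sum_u step_prob f g t u * v u <= v t) ->
    (forall t, stage_reward t + \sum_u step_prob f g t u * h u <= v t + h t) ->
  forall s, undiscounted_payoff f g s <= v s.
Proof.
move=> super bias s; have [c c0 ub] := average_le super bias.
have [M bM] := average_bounded.
apply: (@limn_inf_le R (average ^~ s) (v s) c (- M)) => // N.
by have /andP[] := bM N s.
Qed.

End Averages.
(** * A potential measuring the time spent in transient states *)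

Section EscapePotential.
Variables (R : realType) (S : finType) (P : S -> S -> R) (Y : pred S).

(** The operator 1 - Q, where Q is the restriction of P to Y x Y. *)
Definition killed_generator (z : {ffun S -> R^o}) : {ffun S -> R^o} :=
  [ffun s => z s - (if Y s then \sum_(t | Y t) P s t * z t else 0)].

Lemma killed_generator_is_linear : linear killed_generator.
Proof.
move=> k z w; apply/ffunP => s; rewrite !ffunE /=.
case: (Y s); last by rewrite !subr0.
have -> : \sum_(t | Y t) P s t * (k *: z + w) t =
    k * (\sum_(t | Y t) P s t * z t) + \sum_(t | Y t) P s t * w t.
  rewrite mulr_sumr -big_split; apply: eq_bigr => t _.
  by rewrite !ffunE /GRing.scale /=; ring.
by rewrite /GRing.scale /=; ring.
Qed.

HB.instance Definition _ :=
  GRing.isLinear.Build R {ffun S -> R^o} {ffun S -> R^o} *:%R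
    killed_generator killed_generator_is_linear.

(** The weight y, a strict supersolution from the left, makes 1 - Q injective:
    pairing y with the absolute value of an element z of the kernel gives
    y |z| <= y Q |z| <= (y - 1_Y) |z|, so z vanishes on Y.  In finite dimension
    1 - Q is then onto, and e is a preimage of the indicator of Y. *)
Lemma escape_potential (y : S -> R) :
    (forall s t, 0 <= P s t) -> (forall s, 0 <= y s) ->
    (forall t, Y t -> 1 + \sum_(s | Y s) y s * P s t <= y t) ->
  exists e : S -> R, (forall s, ~~ Y s -> e s = 0) /\
    (forall s, Y s -> e s = 1 + \sum_t P s t * e t).
Proof.
move=> P0 y0 yP; pose F := linfun killed_generator.
have FE z : F z = killed_generator z by rewrite /F lfunE.
have inj : lker F == 0%VS.
  apply/lker0P; apply: raddf_inj => z; rewrite [LHS]FE => /ffunP Fz.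
  have zout s : ~~ Y s -> z s = 0.
    by move=> /negbTE Ys; have := Fz s; rewrite !ffunE Ys subr0.
  have zin s : Y s -> `|z s| <= \sum_(t | Y t) P s t * `|z t|.
    move=> Ys; have := Fz s; rewrite !ffunE Ys => /eqP.
    rewrite subr_eq0 => /eqP ->.
    apply: le_trans (ler_norm_sum _ _ _) _; apply: ler_sum => t _.
    by rewrite normrM ger0_norm.
  have le1 : \sum_(s | Y s) y s * `|z s| <= \sum_(t | Y t) (y t - 1) * `|z t|.
    apply: (@le_trans _ _ (\sum_(s | Y s) y s * \sum_(t | Y t) P s t * `|z t|)).
      by apply: ler_sum => s Ys; rewrite ler_wpM2l ?zin.
    under eq_bigr do rewrite mulr_sumr.
    rewrite exchange_big; apply: ler_sum => t Yt /=.
    under eq_bigr do rewrite mulrA.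
    by rewrite -mulr_suml ler_wpM2r// lerBrDl yP.
  have z0 : \sum_(s | Y s) `|z s| <= 0.
    move: le1; under [leRHS]eq_bigr do rewrite mulrBl mul1r.
    by rewrite sumrB; lra.
  apply/ffunP => s; rewrite ffunE; have [Ys|/zout//] := boolP (Y s).
  apply/eqP; rewrite -normr_le0 (le_trans _ z0)//.
  by rewrite (bigD1 s)//= lerDl sumr_ge0.
have : [ffun s => (Y s)%:R : R^o] \in limg F by rewrite lker0_limgf// memvf.
move=> /memv_imgP[e _]; rewrite FE => /ffunP eE.
exists e; split => s Ys; have := eE s; rewrite !ffunE.
  by rewrite (negbTE Ys) subr0.
rewrite Ys => es.
rewrite -[LHS](subrK (\sum_(t | Y t) P s t * e t)) -es; congr (_ + _).
rewrite [RHS](bigID Y)/= [X in _ = _ + X]big1 ?addr0// => t Yt.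
by have := eE t; rewrite !ffunE (negbTE Yt) subr0 => <-; rewrite mulr0.
Qed.

End EscapePotential.

(** * Certificates of optimality *)

Section MixedActions.
Variable R : realType.

Lemma mixed_delta m (i : 'I_m) : mixed (delta_mx 0 i : 'rV[R]_m).
Proof.
split=> [k|]; first by rewrite mxE ler0n.
rewrite (bigD1 i)//= mxE !eqxx big1 ?addr0// => k /negbTE ki.
by rewrite mxE ki andbF.
Qed.

Lemma expected_sum_col m n (A : 'M[R]_(m, n)) x y :
  expected A x y = \sum_j y 0 j * (x *m A) 0 j.
Proof.
by rewrite /expected mxE; apply: eq_bigr => j _; rewrite [y^T _ _]mxE mulrC.
Qed.

Lemma expected_sum_row m n (A : 'M[R]_(m, n)) x y :
  expected A x y = \sum_i x 0 i * (A *m y^T) i 0.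
Proof. by rewrite /expected -mulmxA mxE. Qed.

Lemma mixed_mean_le m (x : 'rV[R]_m) (a : 'I_m -> R) c :
  mixed x -> (forall i, a i <= c) -> \sum_i x 0 i * a i <= c.
Proof.
move=> [x0 x1] ac; rewrite -[leRHS]mul1r -x1 mulr_suml.
by apply: ler_sum => i _; rewrite ler_wpM2l.
Qed.

Lemma mixed_mean_ge m (x : 'rV[R]_m) (a : 'I_m -> R) c :
  mixed x -> (forall i, c <= a i) -> c <= \sum_i x 0 i * a i.
Proof.
move=> [x0 x1] ac; rewrite -[leLHS]mul1r -x1 mulr_suml.
by apply: ler_sum => i _; rewrite ler_wpM2l.
Qed.

Lemma mixed_mean_cst m (x : 'rV[R]_m) c : mixed x -> \sum_i x 0 i * c = c.
Proof. by move=> [_ x1]; rewrite -mulr_suml x1 mul1r. Qed.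

Lemma mixed_mean_attained m (x : 'rV[R]_m) (a : 'I_m -> R) c :
    mixed x -> positive x -> (forall i, a i <= c) -> c <= \sum_i x 0 i * a i ->
  forall i, a i = c.
Proof.
move=> mx px ac cle i; apply/eqP; rewrite eq_sym -subr_eq0.
have d0 k : true -> 0 <= x 0 k * (c - a k).
  by move=> _; rewrite mulr_ge0 ?subr_ge0// mx.1.
have s0 : \sum_k x 0 k * (c - a k) = 0.
  apply: le_anti; rewrite sumr_ge0// andbT.
  under eq_bigr do rewrite mulrBr.
  by rewrite sumrB mixed_mean_cst// subr_le0.
have := @psumr_eq0P _ _ xpredT _ d0 s0 i isT.
by move=> /eqP; rewrite mulf_eq0 gt_eqF.
Qed.

End MixedActions.

Section Certificates.
Variables (R : realType) (S : finType) (G : stochastic_game R S).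
Variable q : forall s, 'I_(m2 G s) -> S -> R.
Hypothesis qE : forall s (i : 'I_(m1 G s)) (j : 'I_(m2 G s)) s',
  trans i j s' = q j s'.

Definition next_mean (w : S -> R) (s : S) (j : 'I_(m2 G s)) : R :=
  \sum_t q j t * w t.

Lemma q_ge0 s (j : 'I_(m2 G s)) t : 0 <= q j t.
Proof. by rewrite -(qE (Ordinal (m1_gt0 G s))) trans_ge0. Qed.

Lemma q_sum1 s (j : 'I_(m2 G s)) : \sum_t q j t = 1.
Proof.
rewrite -(trans_sum1 (Ordinal (m1_gt0 G s)) j).
by apply: eq_bigr => t _; rewrite qE.
Qed.

Lemma next_mean_cst c s (j : 'I_(m2 G s)) : next_mean (fun=> c) j = c.
Proof. by rewrite /next_mean -mulr_suml q_sum1 mul1r. Qed.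

Lemma next_mean_lin c (w w' : S -> R) s (j : 'I_(m2 G s)) :
  next_mean (fun t => w t + c * w' t) j = next_mean w j + c * next_mean w' j.
Proof.
rewrite /next_mean mulr_sumr -big_split; apply: eq_bigr => t _.
by rewrite mulrDr mulrCA.
Qed.

Lemma step_prob_next_mean f g w s : stationary1 f ->
  \sum_t step_prob f g s t * w t = \sum_j g s 0 j * next_mean w j.
Proof.
move=> hf; under eq_bigr => t _.
  rewrite /step_prob exchange_big /= mulr_suml.
  under eq_bigr => j _.
    under eq_bigr do rewrite qE -mulrA.
    rewrite (mixed_mean_cst _ (hf s)) -mulrA.
    over.
  over.
rewrite exchange_big /=; apply: eq_bigr => j _.
by rewrite -mulr_sumr.
Qed.

(** In terms of the one-step operators of player 2, [cert_subharmonic] and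
    [cert_bias] say that f guarantees v, the other conditions that g does.
    Player 1 is constrained only on X: by [cert_drift] play leaves the
    complement of X fast enough for its rewards not to matter on average. *)
Record certificate (f : profile1 G) (g : profile2 G) (X : {set S})
    (v h e : S -> R) : Prop := Certificate {
  cert_stationary1 : stationary1 f;
  cert_stationary2 : stationary2 g;
  cert_subharmonic : forall s (j : 'I_(m2 G s)), v s <= next_mean v j;
  cert_bias : forall s (j : 'I_(m2 G s)),
    v s + h s <= (f s *m reward G s) 0 j + next_mean h j;
  cert_harmonic : forall s, v s = \sum_j g s 0 j * next_mean v j;
  cert_best_reply : forall s i, s \in X ->
    (reward G s *m (g s)^T) i 0 + \sum_j g s 0 j * next_mean h j <= v s + h s;
  cert_drift : forall s, \sum_j g s 0 j * next_mean e j + (s \notin X)%:R <= e s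
}.

(** Against g the bias must be corrected outside X, where [cert_best_reply] is
    silent: adding a large multiple of e to h makes up for any defect there
    and, as e does not increase in mean, spoils nothing on X. *)
Lemma certificate_optimal f g X v h e :
  certificate f g X v h e -> optimal_pair f g.
Proof.
case=> sf sg sub bias harm best drift.
have ge g' : stationary2 g' -> forall s, v s <= undiscounted_payoff f g' s.
  move=> sg' s; apply: (undiscounted_payoff_ge sf sg' (v := v) (h := h)) => t.
    by rewrite step_prob_next_mean//; apply: mixed_mean_ge.
  rewrite step_prob_next_mean// /stage_reward expected_sum_col -big_split /=.
  under [leRHS]eq_bigr do rewrite -mulrDr.
  exact: mixed_mean_ge.
have le f' : stationary1 f' -> forall s, undiscounted_payoff f' g s <= v s.
  move=> sf'.
  have [M M0 hM] := sup_norm (fun t => stage_reward f' g t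
    + \sum_j g t 0 j * next_mean h j - v t - h t).
  apply: (undiscounted_payoff_le sf' sg
    (v := v) (h := fun t => h t + M * e t)) => t.
    by rewrite step_prob_next_mean// -harm.
  rewrite step_prob_next_mean//.
  under eq_bigr do rewrite next_mean_lin mulrDr mulrCA.
  rewrite big_split /= -mulr_sumr.
  have := drift t; have [tX|tX] := boolP (t \in X) => /= dr.
    have : stage_reward f' g t + \sum_j g t 0 j * next_mean h j <= v t + h t.
      rewrite /stage_reward expected_sum_row -lerBrDr.
      by apply: mixed_mean_le => // i; rewrite lerBrDr best.
    have := ler_wpM2l M0 dr; lra.
  have := hM t; rewrite ler_norml => /andP[_].
  have := ler_wpM2l M0 dr; lra.
split=> // [f' sf' s|g' sg' s].
  exact: le_trans (le _ sf' s) (ge _ sg s).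
exact: le_trans (le _ sf s) (ge _ sg' s).
Qed.

End Certificates.
(** * Existence of a certificate *)

Lemma big_tagged (R : nmodType) (S : finType) (T : S -> finType)
    (F : {s : S & T s} -> R) :
  \sum_p F p = \sum_s \sum_(j : T s) F (existT T s j).
Proof.
rewrite (@sig_big_dep _ _ _ _ _ xpredT (fun _ => xpredT)
  (fun s j => F (existT T s j))).
by apply: eq_bigr => -[s j].
Qed.

Section Existence.
Variables (R : realType) (S : finType) (G : stochastic_game R S).
Variable q : forall s, 'I_(m2 G s) -> S -> R.
Hypothesis qE : forall s (i : 'I_(m1 G s)) (j : 'I_(m2 G s)) s',
  trans i j s' = q j s'.

Let first1 s : 'I_(m1 G s) := Ordinal (m1_gt0 G s).
Let first2 s : 'I_(m2 G s) := Ordinal (m2_gt0 G s).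

(** Boundedness of the program below: with null rewards N v stays bounded as N
    grows. *)
Lemma subharmonic_bias_le0 (v h : S -> R) :
    (forall s (j : 'I_(m2 G s)), v s <= next_mean q v j) ->
    (forall s (j : 'I_(m2 G s)), v s + h s <= next_mean q h j) ->
  forall s, v s <= 0.
Proof.
move=> sub bias s.
pose f : profile1 G := fun s => delta_mx 0 (first1 s).
pose g : profile2 G := fun s => delta_mx 0 (first2 s).
have sf : stationary1 f by move=> t; exact: mixed_delta.
have sg : stationary2 g by move=> t; exact: mixed_delta.
have [M M0 hM] := sup_norm h.
have sub' t : v t <= \sum_u step_prob f g t u * v u.
  by rewrite (step_prob_next_mean qE)//; exact: mixed_mean_ge.
have bias' t : v t + h t <= 0 + \sum_u step_prob f g t u * h u.
  by rewrite (step_prob_next_mean qE)// add0r; exact: mixed_mean_ge.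
have sums N : N%:R * v s <= M + M.
  have := sum_rewards_ge sf sg (rho := fun=> 0) N s sub' bias'.
  rewrite [X in _ <= X]big1 => [|n _]; last first.
    by rewrite big1 // => t _; rewrite mulr0.
  have : \sum_t state_prob f g N s t * h t <= M.
    rewrite -(state_prob_cst sf sg N s M); apply: state_prob_mono => // t.
    by have := hM t; rewrite ler_norml => /andP[].
  have : - M <= h s by have := hM s; rewrite ler_norml => /andP[].
  lra.
rewrite leNgt; apply/negP => v0.
have := archi_boundP (divr_ge0 (addr_ge0 M0 M0) (ltW v0)).
by rewrite ltr_pdivrMr// ltNge sums.
Qed.

(** A primal-dual solution of the program that maximizes the sum of v over
    (f, v, h).  The weights x and y are the multipliers of the bias and of the
    subharmonicity constraints.  The five last conclusions are complementary
    slackness, the dual equations for the variables h and v, and the dual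
    equation for f combined with the slackness of f >= 0. *)
Lemma optimality_program : exists (f : profile1 G) (v h : S -> R)
    (x y : forall s, 'I_(m2 G s) -> R),
  [/\ stationary1 f,
      forall s (j : 'I_(m2 G s)), v s <= next_mean q v j,
      forall s (j : 'I_(m2 G s)),
        v s + h s <= (f s *m reward G s) 0 j + next_mean q h j,
      (forall s j, 0 <= x s j) /\ (forall s j, 0 <= y s j)
    & [/\ forall s j, y s j * (next_mean q v j - v s) = 0,
      forall s j, x s j *
        ((f s *m reward G s) 0 j + next_mean q h j - (v s + h s)) = 0,
      forall w, \sum_s \sum_j x s j * (w s - next_mean q w j) = 0,
      forall w, \sum_s \sum_j y s j * (w s - next_mean q w j) +
        \sum_s (\sum_j x s j) * w s = \sum_s w s
    & forall s i, \sum_j x s j * reward G s i j <=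
        \sum_j x s j * (f s *m reward G s) 0 j]].
Proof.
pose T1 := {s : S & 'I_(m1 G s)}; pose T2 := {s : S & 'I_(m2 G s)}.
pose V := ((S -> R^o) * (S -> R^o) * (T1 -> R^o))%type.
pose cv (w : V) s : R := w.1.1 s; pose ch (w : V) s : R := w.1.2 s.
pose cf (w : V) s i : R := w.2 (existT _ s i).
pose I := ((T2 + T2) + (S + S) + T1)%type.
pose a (k : I) (w : V) : R := match k with
  | inl (inl (inl (existT s j))) => cv w s - next_mean q (cv w) j
  | inl (inl (inr (existT s j))) => (cv w s + ch w s) -
      (next_mean q (ch w) j + \sum_i reward G s i j * cf w s i)
  | inl (inr (inl s)) => \sum_i cf w s i
  | inl (inr (inr s)) => -1 * \sum_i cf w s i
  | inr (existT s i) => -1 * cf w s i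
  end.
pose b (k : I) : R := match k with
  | inl (inr (inl s)) => 1 | inl (inr (inr s)) => -1 | _ => 0 end.
pose c (w : V) : R := \sum_s cv w s.
have lcv s : scalar (cv ^~ s) by move=> k u w.
have lch s : scalar (ch ^~ s) by move=> k u w.
have lcf s i : scalar (fun w => cf w s i) by move=> k u w.
have lnv s (j : 'I_(m2 G s)) : scalar (fun w => next_mean q (cv w) j).
  by apply: scalar_sum => t; apply: scalar_mulrl.
have lnh s (j : 'I_(m2 G s)) : scalar (fun w => next_mean q (ch w) j).
  by apply: scalar_sum => t; apply: scalar_mulrl.
have la k : scalar (a k).
  case: k => [[[[s j]|[s j]]|[s|s]]|[s i]] /=.
  - exact: scalarB.
  - apply: scalarB; first exact: scalarD.
    by apply: scalarD => //; apply: scalar_sum => i; apply: scalar_mulrl.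
  - exact: scalar_sum.
  - by apply: scalar_mulrl; apply: scalar_sum.
  - exact: scalar_mulrl.
have lc : scalar c by apply: scalar_sum.
have first_sumE s (r : 'I_(m1 G s) -> R) :
    \sum_i r i * (i == first1 s)%:R = r (first1 s).
  rewrite (bigD1 (first1 s)) //= big1 => [|i /negbTE ->]; last by rewrite mulr0.
  by rewrite mulr1 addr0.
have first_sum1 s : \sum_i (i == first1 s)%:R = 1 :> R.
  rewrite -[RHS](first_sumE s (fun=> 1)).
  by apply: eq_bigr => i _; rewrite /= mul1r.
have [|u uneg|[[v h] f] [l [feas l0 lag slack]]] :=
    @linear_program_duality R V I a b c la lc.
- have [M M0 hM] := sup_norm
    (fun p : T2 => reward G (tag p) (first1 _) (tagged p)).
  exists (fun=> - M, fun=> 0, fun p : T1 => (tagged p == first1 (tag p))%:R).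
  case=> [[[[s j]|[s j]]|[s|s]]|[s i]]; rewrite /a /b /cv /ch /cf /=.
  + by rewrite (next_mean_cst qE) subrr.
  + rewrite first_sumE (next_mean_cst qE) addr0 add0r subr_le0.
    by have := hM (existT _ s j); rewrite ler_norml => /andP[].
  + by rewrite first_sum1.
  + by rewrite first_sum1 mulr1.
  + by rewrite mulN1r oppr_le0.
- have cf0 s i : cf u s i = 0.
    have f0 k : true -> 0 <= cf u s k.
      by move=> _; have := uneg (inr (existT _ s k)); rewrite /= mulN1r oppr_le0.
    apply: (@psumr_eq0P _ _ xpredT _ f0) => //.
    apply: le_anti; rewrite sumr_ge0// andbT.
    exact: uneg (inl (inr (inl s))).
  apply: sumr_le0 => s _; apply: (@subharmonic_bias_le0 (cv u) (ch u)) => t j.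
    by have := uneg (inl (inl (inl (existT _ t j)))); rewrite /= subr_le0.
  have := uneg (inl (inl (inr (existT _ t j)))); rewrite /= subr_le0.
  by rewrite [X in _ <= _ + X]big1 ?addr0// => i _; rewrite cf0 mulr0.
pose x s (j : 'I_(m2 G s)) : R := l (inl (inl (inr (existT _ s j)))).
pose y s (j : 'I_(m2 G s)) : R := l (inl (inl (inl (existT _ s j)))).
(* the equality sum f = 1 is a pair of inequalities, hence a signed multiplier *)
pose wt s : R := l (inl (inr (inl s))) - l (inl (inr (inr s))).
pose u s (i : 'I_(m1 G s)) : R := l (inr (existT _ s i)).
pose fp : profile1 G := fun s => \row_i f (existT _ s i).
have fpE s j : (fp s *m reward G s) 0 j =
    \sum_i reward G s i j * f (existT _ s i).
  by rewrite mxE; apply: eq_bigr => i _; rewrite mxE mulrC.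
have fp1 s : mixed (fp s).
  split=> [i|].
    by have := feas (inr (existT _ s i)); rewrite mxE /= mulN1r oppr_le0.
  under eq_bigr do rewrite mxE.
  apply: le_anti; rewrite (feas (inl (inr (inl s)))) /=.
  by have := feas (inl (inr (inr s))); rewrite /= mulN1r lerN2.
have lagE (w : V) :
    \sum_s \sum_j y s j * (cv w s - next_mean q (cv w) j) +
    \sum_s \sum_j x s j * ((cv w s + ch w s) -
      (next_mean q (ch w) j + \sum_i reward G s i j * cf w s i)) +
    \sum_s wt s * (\sum_i cf w s i) - \sum_s \sum_i u s i * cf w s i
    = \sum_s cv w s.
  rewrite -[RHS](lag w) !big_sumType /= !big_tagged /= -!addrA.
  congr (_ + (_ + _)).
  rewrite addrA -big_split /= -sumrN; congr (_ + _); apply: eq_bigr => s _.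
    by rewrite /wt; ring.
  by rewrite -sumrN; apply: eq_bigr => i _; rewrite mulrCA mulN1r.
have next0 s (j : 'I_(m2 G s)) : next_mean q (fun=> 0) j = 0.
  exact: next_mean_cst.
have sum0 s (j : 'I_(m2 G s)) : \sum_i reward G s i j * 0 = 0.
  by rewrite big1// => i _; rewrite mulr0.
(* the dual equation for the variable f s i *)
have wtE s i : \sum_j x s j * reward G s i j = wt s - u s i.
  have [d [cvd chd cfd cfs]] : exists d : V,
      [/\ cv d = fun=> 0, ch d = fun=> 0, forall t k, t != s -> cf d t k = 0
      & forall k, cf d s k = (k == i)%:R].
    exists (fun=> 0, fun=> 0, fun p : T1 => (p == existT _ s i)%:R).
    split=> // [t k ts|k]; rewrite /cf /= -tag_eqE /tag_eq /=.
      by rewrite (negbTE ts).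
    by rewrite eqxx tagged_asE.
  have pick (r : 'I_(m1 G s) -> R) : \sum_k r k * (k == i)%:R = r i.
    rewrite (bigD1 i) //= eqxx mulr1 big1 ?addr0// => k /negbTE ->.
    by rewrite mulr0.
  have := lagE d; rewrite cvd chd [RHS]big1//.
  rewrite big1 ?add0r => [|t _]; last first.
    by rewrite big1// => j _; rewrite next0 subrr mulr0.
  rewrite (bigD1 s)//= [\sum_(t | t != s) _]big1 ?addr0 => [|t ts]; last first.
    rewrite big1// => j _; rewrite [\sum_k _]big1 => [|k _]; last first.
      by rewrite cfd ?mulr0.
    by rewrite next0 !addr0 subrr mulr0.
  rewrite [\sum_t wt t * _](bigD1 s)//=.
  rewrite [\sum_(t | t != s) _]big1 ?addr0 => [|t ts]; last first.
    by rewrite big1 ?mulr0// => k _; rewrite cfd.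
  rewrite [\sum_t \sum_k u t k * _](bigD1 s)//=.
  rewrite [\sum_(t | t != s) _]big1 ?addr0 => [|t ts]; last first.
    by rewrite big1// => k _; rewrite cfd ?mulr0.
  under [\sum_k cf d s k]eq_bigr do rewrite cfs -[_%:R]mul1r.
  under [\sum_k u s k * _]eq_bigr do rewrite cfs.
  rewrite !pick mulr1.
  have -> : \sum_j x s j * (0 -
      (next_mean q (fun=> 0) j + \sum_k reward G s k j * cf d s k)) =
      - \sum_j x s j * reward G s i j.
    rewrite -sumrN; apply: eq_bigr => j _.
    under eq_bigr do rewrite cfs.
    by rewrite pick next0 !add0r mulrN.
  lra.
exists fp, v, h, x, y; split=> //.
- move=> s j; have := feas (inl (inl (inl (existT _ s j)))).
  by rewrite /= subr_le0.
- move=> s j; have := feas (inl (inl (inr (existT _ s j)))).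
  by rewrite /= subr_le0 fpE [_ + next_mean _ _ _]addrC.
- by split=> s j; exact: l0.
split=> [s j|s j|w|w|s i].
- by have := slack (inl (inl (inl (existT _ s j)))); rewrite /= sub0r opprB.
- have := slack (inl (inl (inr (existT _ s j)))).
  by rewrite /= sub0r opprB fpE [next_mean _ _ _ + _]addrC.
- have := lagE (fun=> 0, w, fun=> 0); rewrite [RHS]big1//.
  rewrite big1 ?add0r => [|s _]; last first.
    by rewrite big1// => j _; rewrite /cv /= next0 subrr mulr0.
  rewrite [\sum_s wt s * _]big1 ?addr0 => [|s _]; last by rewrite big1 ?mulr0.
  rewrite [\sum_s \sum_i u s i * _]big1 ?subr0 => [|s _]; last first.
    by rewrite big1// => i _; rewrite mulr0.
  move=> lagw; rewrite -[RHS]lagw.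
  apply: eq_bigr => s _; apply: eq_bigr => j _.
  by rewrite /cv /ch /cf /= sum0 addr0 add0r.
- have := lagE (w, fun=> 0, fun=> 0).
  rewrite [\sum_s wt s * _]big1 ?addr0 => [|s _]; last by rewrite big1 ?mulr0.
  rewrite [\sum_s \sum_i u s i * _]big1 ?subr0 => [|s _]; last first.
    by rewrite big1// => i _; rewrite mulr0.
  move=> <-; congr (_ + _); apply: eq_bigr => s _; rewrite mulr_suml.
  apply: eq_bigr => j _; rewrite /cv /ch /cf /= sum0 next0.
  by rewrite !addr0 subr0.
- have -> : \sum_j x s j * (fp s *m reward G s) 0 j = wt s.
    under eq_bigr do rewrite mxE mulr_sumr.
    rewrite exchange_big /= -[RHS](mixed_mean_cst _ (fp1 s)).
    apply: eq_bigr => k _; under eq_bigr do rewrite mulrCA.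
    rewrite -mulr_sumr wtE mulrBr [X in _ - X](_ : _ = 0) ?subr0//.
    have := slack (inr (existT _ s k)).
    by rewrite /= mulN1r sub0r opprK mxE mulrC.
  by rewrite wtE gerBl; exact: l0.
Qed.

End Existence.
Section CertificateExistence.
Variables (R : realType) (S : finType) (G : stochastic_game R S).
Variable q : forall s, 'I_(m2 G s) -> S -> R.
Hypothesis qE : forall s (i : 'I_(m1 G s)) (j : 'I_(m2 G s)) s',
  trans i j s' = q j s'.

(** By the dual equation for h, x is an invariant measure of the chain of g, so
    its support X is closed.  By the dual equation for v, y has mass at least 1
    in each state outside X and is there a strict supersolution in the sense of
    [escape_potential].  Slackness of x gives the best-reply condition on X,
    slackness of y the harmonicity of v outside X; inside X harmonicity follows
    from subharmonicity integrated against the invariant measure x. *)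
Lemma certificate_exists :
  exists (f : profile1 G) (g : profile2 G) (X : {set S}) (v h e : S -> R),
    certificate q f g X v h e.
Proof.
have [f [v [h [x [y [sf sub bias [x0 y0] [slacky slackx inv dual best]]]]]]] :=
  optimality_program qE.
pose X := [set s | 0 < \sum_j x s j].
have xX s : s \notin X -> forall j, x s j = 0.
  rewrite inE -leNgt => xs j; apply: (@psumr_eq0P _ _ xpredT (x s)) => //.
  by apply: le_anti; rewrite xs sumr_ge0.
have pick t (a : S -> R) : \sum_s a s * (s == t)%:R = a t.
  rewrite (bigD1 t) //= eqxx mulr1 big1 ?addr0// => s /negbTE ->.
  by rewrite mulr0.
have nextt t s (j : 'I_(m2 G s)) : next_mean q (fun s => (s == t)%:R) j = q j t.
  exact: pick.
have out t : t \notin X ->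
    1 + \sum_s \sum_j y s j * q j t = \sum_j y t j.
  move=> tX; have := dual (fun s => (s == t)%:R).
  have -> : \sum_s (s == t)%:R = 1 :> R.
    by rewrite -[RHS](pick t (fun=> 1)); apply: eq_bigr => s _; rewrite mul1r.
  rewrite [\sum_s (\sum_j x s j) * _]pick [\sum_j x t j]big1 ?addr0; last first.
    by move=> j _; exact: xX.
  move=> <-; under [\sum_s \sum_j y s j * (_ - _)]eq_bigr => s _.
    under eq_bigr do rewrite nextt mulrBr.
    rewrite sumrB -mulr_suml.
    over.
  by rewrite sumrB pick subrK.
have closed s j t : s \in X -> t \notin X -> x s j * q j t = 0.
  move=> sX tX; have := inv (fun s => (s == t)%:R).
  under eq_bigr => r _.
    under eq_bigr do rewrite nextt mulrBr.
    rewrite sumrB -mulr_suml.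
    over.
  rewrite sumrB pick [\sum_j x t j]big1; last by move=> k _; exact: xX.
  rewrite sub0r => /eqP; rewrite oppr_eq0 => /eqP sum0.
  have nn r : true -> 0 <= \sum_j x r j * q j t.
    by move=> _; apply: sumr_ge0 => k _; rewrite mulr_ge0 ?x0 ?(q_ge0 qE).
  have := @psumr_eq0P _ _ xpredT _ nn sum0 s isT.
  move=> sums0.
  apply: (@psumr_eq0P _ _ xpredT (fun j => x s j * q j t)) => // k _.
  by rewrite mulr_ge0 ?x0 ?(q_ge0 qE).
pose z s j := if s \in X then x s j else y s j.
have z0 s j : 0 <= z s j by rewrite /z; case: ifP.
have zs0 s : 0 < \sum_j z s j.
  rewrite /z; have [|sX] := boolP (s \in X); first by rewrite inE.
  rewrite -(out s sX) ltr_pwDl// sumr_ge0// => t _; apply: sumr_ge0 => j _.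
  by rewrite mulr_ge0 ?y0 ?(q_ge0 qE).
pose g : profile2 G := fun s => \row_j (z s j / \sum_k z s k).
have gE s (a : 'I_(m2 G s) -> R) :
    (\sum_k z s k) * (\sum_j g s 0 j * a j) = \sum_j z s j * a j.
  rewrite mulr_sumr; apply: eq_bigr => j _; rewrite mxE.
  by rewrite mulrA mulrCA divff ?mulr1// gt_eqF.
have sg : stationary2 g.
  move=> s; split=> [j|]; first by rewrite mxE divr_ge0 ?z0 ?ltW.
  apply: (mulfI (lt0r_neq0 (zs0 s))); rewrite mulr1.
  have -> : \sum_j g s 0 j = \sum_j g s 0 j * 1.
    by apply: eq_bigr => j _; rewrite mulr1.
  by rewrite gE; apply: eq_bigr => j _; rewrite mulr1.
have zharm s j : z s j * (next_mean q v j - v s) = 0.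
  rewrite /z; case: ifPn => // sX.
  have nn r k : 0 <= x r k * (next_mean q v k - v r).
    by rewrite mulr_ge0// subr_ge0.
  have sum0 : \sum_r \sum_k x r k * (next_mean q v k - v r) = 0.
    apply/eqP; rewrite -oppr_eq0 -sumrN -[X in _ == X](inv v); apply/eqP.
    apply: eq_bigr => r _; rewrite -sumrN; apply: eq_bigr => k _.
    by rewrite -mulrN opprB.
  have := @psumr_eq0P _ _ xpredT _ (fun r _ => sumr_ge0 _ (fun k _ => nn r k))
    sum0 s isT.
  move=> sums0.
  exact: (@psumr_eq0P _ _ xpredT (fun j => x s j * (next_mean q v j - v s))).
have [e [ein eout]] : exists e : S -> R,
    (forall s, ~~ (s \notin X) -> e s = 0) /\
    (forall s, s \notin X -> e s = 1 + \sum_t (\sum_j g s 0 j * q j t) * e t).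
  apply: (@escape_potential R S _ [pred s | s \notin X]
    (fun s => \sum_j y s j)).
  - move=> s t; apply: sumr_ge0 => j _.
    by rewrite mulr_ge0 ?(q_ge0 qE) ?(sg s).1.
  - by move=> s; apply: sumr_ge0.
  move=> t /= tX; rewrite -(out t tX) lerD2l.
  rewrite [leRHS](bigID [pred s | s \notin X])/=.
  rewrite -[leLHS]addr0; apply: lerD; last first.
    apply: sumr_ge0 => s _; apply: sumr_ge0 => j _.
    by rewrite mulr_ge0 ?y0 ?(q_ge0 qE).
  apply: ler_sum => s sX; have := gE s (fun j => q j t).
  by rewrite /z (negbTE sX) => ->.
exists f, g, X, v, h, e; split=> // [s|s i sX|s].
- apply: (mulfI (lt0r_neq0 (zs0 s))); rewrite gE mulr_suml.
  apply: eq_bigr => j _.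
  by have /eqP := zharm s j; rewrite mulrBr subr_eq0 => /eqP.
- rewrite mxE; under eq_bigr do rewrite [_^T _ _]mxE mulrC.
  rewrite -(ler_pM2l (zs0 s)) mulrDr !gE.
  have zx j : z s j = x s j by rewrite /z sX.
  under eq_bigr do rewrite zx.
  rewrite (le_trans (lerD (best s i) (lexx _)))//.
  under [X in _ + X]eq_bigr do rewrite zx.
  rewrite -big_split mulr_suml /=; apply: ler_sum => j _.
  by have /eqP := slackx s j; rewrite mulrBr subr_eq0 mulrDr zx => /eqP ->.
have nextE : \sum_j g s 0 j * next_mean q e j =
    \sum_t (\sum_j g s 0 j * q j t) * e t.
  under [RHS]eq_bigr do rewrite mulr_suml.
  rewrite exchange_big; apply: eq_bigr => j _; rewrite mulr_sumr.
  by apply: eq_bigr => t _; rewrite mulrA.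
rewrite nextE; have [sX|sX] := boolP (s \in X); last first.
  by rewrite [leRHS]eout// addrC.
rewrite addr0 [leRHS]ein ?negbK// big1// => t _.
have [tX|tX] := boolP (t \in X); first by rewrite ein ?negbK// mulr0.
suff -> : \sum_j g s 0 j * q j t = 0 by rewrite mul0r.
apply: (mulfI (lt0r_neq0 (zs0 s))); rewrite gE mulr0 big1// => j _.
by rewrite /z sX closed.
Qed.

End CertificateExistence.
(** * Symmetric matrix games *)

Section SymmetricGames.
Variable R : realType.

Lemma expected_delta_col m n (A : 'M[R]_(m, n)) x j :
  expected A x (delta_mx 0 j) = (x *m A) 0 j.
Proof.
rewrite expected_sum_col (bigD1 j)//= mxE !eqxx mul1r big1 ?addr0// => k kj.
by rewrite mxE (negbTE kj) andbF mul0r.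
Qed.

Lemma expected_delta_row m n (A : 'M[R]_(m, n)) i y :
  expected A (delta_mx 0 i) y = (A *m y^T) i 0.
Proof.
rewrite expected_sum_row (bigD1 i)//= mxE !eqxx mul1r big1 ?addr0// => k ki.
by rewrite mxE (negbTE ki) andbF mul0r.
Qed.

Lemma mixed_positive_dim1 m (x : 'rV[R]_m) :
  (m <= 1)%N -> mixed x -> positive x.
Proof.
move=> m1 [_ x1] i; rewrite (bigD1 i)//= big1 ?addr0 in x1; first by rewrite x1.
have val0 (k : 'I_m) : val k = 0%N.
  by apply/eqP; rewrite -leqn0 -ltnS (leq_trans (ltn_ord k)).
by move=> j /eqP[]; apply: val_inj; rewrite !val0.
Qed.

(** By symmetry y equalizes as a row strategy too, so c is the value.  As y is
    positive, any optimal strategy of either player also equalizes; read as a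
    row strategy by symmetry, it differs from y by a vector d as in the last
    hypothesis. *)
Lemma completely_mixed_of_equalizer m n (A : 'M[R]_(m, n)) (y : 'rV[R]_n) c :
    symmetric_matrix A -> mixed y -> positive y ->
    (forall i, (A *m y^T) i 0 = c) ->
    (forall d : 'rV[R]_m, d *m A = 0 -> \sum_i d 0 i = 0 -> d = 0) ->
  completely_mixed_matrix_game A.
Proof.
move=> [enm]; subst n; rewrite castmx_id => symA my py Ay ker.
have yA j : (y *m A) 0 j = c.
  by rewrite -(Ay j) [in LHS]symA -[in LHS](trmxK y) -trmx_mul mxE.
have uniq x : mixed x -> (forall j, (x *m A) 0 j = c) -> positive x.
  move=> mx xA; suff -> : x = y by [].
  apply/eqP; rewrite -subr_eq0; apply/eqP; apply: ker.
    apply/rowP => j; rewrite mulmxBl.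
    by have := xA j; have := yA j; rewrite !mxE => -> ->; rewrite subrr.
  under eq_bigr do rewrite !mxE.
  by rewrite sumrB mx.2 my.2 subrr.
have value v : game_value A v -> v = c.
  move=> [[x [mx xv]] [z [mz zv]]]; apply: le_anti; apply/andP; split.
    rewrite (le_trans (xv y my))// expected_sum_row.
    by apply: mixed_mean_le => // i; rewrite Ay.
  rewrite (le_trans _ (zv y my))// expected_sum_col.
  by apply: mixed_mean_ge => // j; rewrite yA.
split=> [x [v /value -> [mx xv]]|z [v /value -> [mz zv]]]; apply: uniq => // j.
  apply: oppr_inj.
  apply: (mixed_mean_attained my py (a := fun j => - (x *m A) 0 j)).
    by move=> k; rewrite lerN2 -expected_delta_col xv//; exact: mixed_delta.
  under eq_bigr do rewrite mulrN.
  rewrite sumrN lerN2 -expected_sum_col expected_sum_row.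
  by apply: mixed_mean_le => // i; rewrite Ay.
have -> : (z *m A) 0 j = (A *m z^T) j 0.
  by rewrite [in LHS]symA -[in LHS](trmxK z) -trmx_mul mxE.
apply: (mixed_mean_attained my py (a := fun j => (A *m z^T) j 0)).
  by move=> k; rewrite -expected_delta_row zv//; exact: mixed_delta.
rewrite -expected_sum_row expected_sum_col.
by apply: mixed_mean_ge => // i; rewrite yA.
Qed.

(** Move from x along d until the first decreasing coordinate reaches zero. *)
Lemma leave_simplex m (x d : 'rV[R]_m) :
    mixed x -> positive x -> \sum_i d 0 i = 0 -> d != 0 ->
  exists t, mixed (x + t *: d) /\ ~ positive (x + t *: d).
Proof.
move=> mx px d1 d0.
have [k dk] : exists k, d 0 k < 0.
  apply: contrapT => nk; move/eqP: d0; apply; apply/rowP => i; rewrite mxE.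
  apply: (@psumr_eq0P _ _ xpredT (d 0)) => // j _.
  by rewrite leNgt; apply/negP => dj; apply: nk; exists j.
pose i := [arg min_(i < k | d 0 i < 0) (x 0 i / - d 0 i)]%O.
have [di imin] : d 0 i < 0 /\
    forall j, d 0 j < 0 -> x 0 i / - d 0 i <= x 0 j / - d 0 j.
  by rewrite /i; case: arg_minP.
exists (x 0 i / - d 0 i); split; last first.
  move=> /(_ i); rewrite !mxE invrN mulrN mulNr divfK ?lt_eqF//.
  by rewrite subrr ltxx.
split=> [j|]; last first.
  under eq_bigr do rewrite !mxE.
  by rewrite big_split /= -mulr_sumr d1 mulr0 addr0 mx.2.
rewrite !mxE; have [dj|dj] := ltP (d 0 j) 0.
  have := imin j dj; rewrite ler_pdivlMr ?oppr_gt0// mulrN; lra.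
rewrite addr_ge0 ?(mx.1 j)// mulr_ge0// divr_ge0 ?(mx.1 i)//.
by rewrite oppr_ge0 ltW.
Qed.

End SymmetricGames.

(** * Perturbations of a certificate, and the theorem *)

Section Perturbations.
Variables (R : realType) (S : finType) (G : stochastic_game R S).
Variable q : forall s, 'I_(m2 G s) -> S -> R.
Hypothesis qE : forall s (i : 'I_(m1 G s)) (j : 'I_(m2 G s)) s',
  trans i j s' = q j s'.
Variables (f : profile1 G) (g : profile2 G) (X : {set S}) (v h e : S -> R).
Hypothesis cert : certificate q f g X v h e.

(** The strategy f enters a certificate only through the vectors f(t) R(t). *)
Lemma certificate_perturb1 s (d : 'rV_(m1 G s)) : d *m reward G s = 0 ->
    mixed (f s + d) ->
  certificate q (dfwith f s (f s + d)) g X v h e.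
Proof.
move=> dR fd; case: cert => sf sg sub bias harm best drift; split=> //.
  by move=> t; case: dfwithP.
move=> t; case: dfwithP => [|t' _]; last exact: bias.
by move=> j; rewrite mulmxDl dR addr0.
Qed.

Hypotheses (pf : completely_mixed1 f) (pg : completely_mixed2 g).

(** No action in the support of f(s) can be worse than the best reply level,
    because the f(s)-average of the rewards reaches it by [cert_bias]. *)
Lemma reward_equalized s : s \in X -> forall i,
  (reward G s *m (g s)^T) i 0 = v s + h s - \sum_j g s 0 j * next_mean q h j.
Proof.
case: cert => sf sg sub bias harm best drift sX i0.
apply: (mixed_mean_attained (sf s) (@pf s)
  (a := fun i => (reward G s *m (g s)^T) i 0)) => [i|].
  by rewrite lerBrDr best.
rewrite -expected_sum_row expected_sum_col lerBlDr -big_split /=.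
under [leRHS]eq_bigr do rewrite -mulrDr.
exact: mixed_mean_ge.
Qed.

(** The g(s)-average of the nonnegative gaps in [cert_subharmonic] is zero. *)
Lemma subharmonic_tight s (j : 'I_(m2 G s)) : next_mean q v j = v s.
Proof.
case: cert => sf sg sub bias harm best drift; apply: oppr_inj.
apply: (mixed_mean_attained (sg s) (@pg s) (a := fun j => - next_mean q v j)).
  by move=> k; rewrite lerN2.
under eq_bigr do rewrite mulrN.
by rewrite sumrN -harm.
Qed.

(** The action with the least mean of e drifts down at least as fast as g(s);
    outside X the potential is the only condition, besides harmonicity of v,
    which every action satisfies by [subharmonic_tight]. *)
Lemma certificate_perturb2 s : s \notin X ->
  exists j, certificate q f (dfwith g s (delta_mx 0 j)) X v h e.
Proof.
move=> sX; pose j0 : 'I_(m2 G s) := Ordinal (m2_gt0 G s).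
pose j := [arg min_(j < j0) next_mean q e j]%O.
have jmin (k : 'I_(m2 G s)) : next_mean q e j <= next_mean q e k.
  by rewrite /j; case: arg_minP => // i _ le_i; exact: le_i.
have pure (a : 'I_(m2 G s) -> R) :
    \sum_k (delta_mx 0 j : 'rV[R]_(m2 G s)) 0 k * a k = a j.
  rewrite (bigD1 j)//= mxE !eqxx mul1r big1 ?addr0// => k kj.
  by rewrite mxE (negbTE kj) andbF mul0r.
exists j; case: cert => sf sg sub bias harm best drift; split=> //.
- by move=> t; case: dfwithP => //; exact: mixed_delta.
- by move=> t; case: dfwithP => //; rewrite pure subharmonic_tight.
- move=> t i tX; rewrite dfwithout ?best//.
  by apply: contraNneq sX => ->.
move=> t; case: dfwithP => [|t' _]; last exact: drift.
rewrite pure (le_trans _ (drift s))// lerD2r.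
exact: mixed_mean_ge.
Qed.

End Perturbations.

Unset Implicit Arguments.

Theorem theorem3p4 (R : realType) (S : finType) (G : stochastic_game R S)
    (hctrl : player2_controlled G)
    (hcm : completely_mixed_game G)
    (hsym : forall s : S, symmetric_matrix (reward G s)) :
  forall s : S, completely_mixed_matrix_game (reward G s).
Proof.
move=> s; have [q qE] := hctrl.
have [f [g [X [v [h [e cert]]]]]] := certificate_exists qE.
have [pf pg] := hcm _ _ (certificate_optimal qE cert).
have [sX|sX] := boolP (s \in X).
  apply: (completely_mixed_of_equalizer (hsym s)
    (cert_stationary2 cert s) (pg s)
    (reward_equalized cert pf sX)) => d dR d1.
  apply/eqP/negPn/negP => d0.
  have [t [mt nt]] := leave_simplex (cert_stationary1 cert s) (pf s) d1 d0.
  have tdR : (t *: d) *m reward G s = 0 by rewrite -scalemxAl dR scaler0.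
  have [/(_ s) + _] := hcm _ _ (certificate_optimal qE
    (certificate_perturb1 cert tdR mt)).
  by rewrite dfwithin.
have [j certj] := certificate_perturb2 cert pg sX.
have [_ /(_ s)] := hcm _ _ (certificate_optimal qE certj).
rewrite dfwithin => pj.
have n1 : (m2 G s <= 1)%N.
  rewrite leqNgt; apply/negP => n2.
  pose k : 'I_(m2 G s) :=
    if val j == 0%N then Ordinal n2 else Ordinal (m2_gt0 G s).
  have := pj k; rewrite mxE /= /k -val_eqE.
  by case: ifP => /= [/eqP ->|]; rewrite ?ltxx// eq_sym => ->; rewrite ltxx.
have m1' : (m1 G s <= 1)%N by have [e21 _] := hsym s; rewrite -e21.
by split=> [x [u _ [mx _]]|y [u _ [my _]]]; apply: mixed_positive_dim1.
Qed.
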